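(* Let $n\geq 5$. If every graph in $\mathcal{GAQ}_{n-1}$ has fractional strong matching preclusion number $2n-3$, then every graph in $\mathcal{GAQ}_n$ has fractional strong matching preclusion number $2n-1$.
   Context: The $n$-dimensional augmented cube $AQ_n$ ($n\geq 1$) has vertex set all binary strings $u_1u_2\cdots u_n$. $AQ_1\cong K_2$ on vertices $0,1$. For $n\geq 2$, $AQ_n$ consists of a copy $AQ^0_{n-1}$ of $AQ_{n-1}$ with $0$ prefixed to every label and a copy $AQ^1_{n-1}$ with $1$ prefixed, plus the following edges: $0u_1\cdots u_{n-1}$ is adjacent to $1v_1\cdots v_{n-1}$ iff either $u_i=v_i$ for all $i$ (cross edge) or $u_i\neq v_i$ for all $i$ (complement edge). Generalized augmented cubes: $\mathcal{GAQ}_4=\{AQ_4\}$; for $n\geq 5$, $\mathcal{GAQ}_n$ consists of all graphs $(V_1\cup V_2, E_1\cup E_2\cup M_1\cup M_2)$ where $(V_1,E_1),(V_2,E_2)$ are (vertex-disjoint copies of, possibly identical) graphs in $\mathcal{GAQ}_{n-1}$ and $M_1,M_2$ are edge-disjoint perfect matchings between $V_1$ and $V_2$; such graphs are $(2n-1)$-regular on $2^n$ vertices. A fractional perfect matching of a graph $G$ is a function $f:E(G)\to[0,1]$ with $\sum_{e\ni v} f(e)=1$ for every vertex $v$. A fractional strong matching preclusion set of $G$ is a set $F\subseteq V(G)\cup E(G)$ such that $G-F$ (delete the vertices and edges of $F$) has no fractional perfect matching; the fractional strong matching preclusion number $fsmp(G)$ is the minimum size of such a set. *)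

(* Defs.v *)
From HB Require Import structures.
From mathcomp Require Import all_boot all_order all_algebra.
Set Implicit Arguments. Unset Strict Implicit. Unset Printing Implicit Defensive.
Import Order.TTheory GRing.Theory Num.Theory.

(* Simple graphs are given by a vertex finType T and an adjacency relation
   e : rel T (all graphs below are symmetric and irreflexive). *)

(* Adjacency in the augmented cube, on binary strings (seq bool), following
   the recursive definition: AQ_1 = K_2; in AQ_n, 0u ~ 0v iff u ~ v in AQ_{n-1}
   (same for prefix 1), and 0u ~ 1v iff u = v (cross edge) or u, v differ in
   every position (complement edge). *)
Fixpoint aq_adj (u v : seq bool) : bool :=
  match u, v with
  | [:: a], [:: b] => a != b
  | a :: u', b :: v' =>
      if a == b then aq_adj u' v'
      else (u' == v') || all2 (fun x y => x != y) u' v'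
  | _, _ => false
  end.

Definition AQ (n : nat) : rel (n.-tuple bool) := fun x y => aq_adj x y.
Arguments AQ n : clear implicits.

Definition graph_iso (T1 T2 : finType) (e1 : rel T1) (e2 : rel T2) : Prop :=
  exists f : T1 -> T2, bijective f /\ forall x y, e2 (f x) (f y) = e1 x y.

Definition gaq_join (T1 T2 : finType) (e1 : rel T1) (e2 : rel T2)
    (m1 m2 : T1 -> T2) : rel (T1 + T2)%type :=
  fun a b =>
    match a, b with
    | inl x, inl y => e1 x y
    | inr x, inr y => e2 x y
    | inl x, inr y => (y == m1 x) || (y == m2 x)
    | inr y, inl x => (y == m1 x) || (y == m2 x)
    end.

(* GAQ n T e : the graph (T, e) belongs to the class GAQ_n (up to relabelling
   of vertices).  M1, M2 edge-disjoint perfect matchings between V1 and V2 are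
   given by bijections m1, m2 : V1 -> V2 with m1 x <> m2 x for all x. *)
Unset Implicit Arguments.
Inductive GAQ : nat -> forall T : finType, rel T -> Prop :=
| GAQ_base (T : finType) (e : rel T) :
    graph_iso e (AQ 4) -> GAQ 4 T e
| GAQ_step (n : nat) (T T1 T2 : finType) (e : rel T) (e1 : rel T1) (e2 : rel T2)
    (m1 m2 : T1 -> T2) :
    5 <= n -> GAQ n.-1 T1 e1 -> GAQ n.-1 T2 e2 ->
    bijective m1 -> bijective m2 -> (forall x, m1 x != m2 x) ->
    graph_iso e (gaq_join e1 e2 m1 m2) -> GAQ n T e.
Set Implicit Arguments.

(* A set F ⊆ V ∪ E is given by a vertex set FV and a set FE of edges, each
   edge represented as the 2-element vertex set {x, y}. *)
Definition is_edge_set (T : finType) (e : rel T) (FE : {set {set T}}) : Prop :=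
  forall A, A \in FE -> exists x y, e x y /\ A = [set x; y].

Definition del_adj (T : finType) (e : rel T) (FV : {set T}) (FE : {set {set T}})
    : rel T :=
  fun x y => [&& e x y, x \notin FV, y \notin FV & [set x; y] \notin FE].

Definition has_fpm (R : realFieldType) (T : finType) (e : rel T)
    (FV : {set T}) (FE : {set {set T}}) : Prop :=
  exists f : T -> T -> R,
    (forall x y, f x y = f y x) /\
    (forall x y, del_adj e FV FE x y -> (0 <= f x y <= 1)%R) /\
    (forall x, x \notin FV -> (\sum_(y | del_adj e FV FE x y) f x y)%R = 1%R).

Definition fsmp_set (R : realFieldType) (T : finType) (e : rel T)
    (FV : {set T}) (FE : {set {set T}}) : Prop :=
  is_edge_set e FE /\ ~ has_fpm R e FV FE.

Definition fsmp_eq (R : realFieldType) (T : finType) (e : rel T) (k : nat) : Prop :=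
  (exists FV FE, fsmp_set R e FV FE /\ #|FV| + #|FE| = k) /\
  (forall FV FE, fsmp_set R e FV FE -> k <= #|FV| + #|FE|).

(* Main.v *)
Require Import Defs.
From HB Require Import structures.
From mathcomp Require Import all_boot all_order all_algebra.
From mathcomp Require Import zify.

(** By Hall's theorem on the bipartite double cover, a graph has a fractional
    perfect matching iff [#|A| <= #|N(A)|] for every vertex set [A], and it is
    enough to test independent [A].

    Put [k = 2n - 4].  Each half of the graph satisfies Hall's condition after
    any [k] faults.  If both halves carry at most [k] of the (at most [k + 2])
    faults, Hall's condition for the whole graph follows by adding up.
    Otherwise one half [V] carries at least [k + 1] faults, so at most one fault
    lies elsewhere.  Let [I] be independent.
    - If [I] meets the other half, spending the unused faults there on
      neighbours of [I] shows that [I] expands by [k] minus at most one in it,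
      which compensates the loss of at most [2] per excess fault in [V].
    - If [I] is a nonempty subset of [V], the two perfect matchings give it at
      least [max(2, #|I|)] neighbours in the other half, of which the outside
      fault destroys at most one.  So Hall's condition holds unless [N(I)] misses
      [V] and [#|I| >= 2].  But then restoring a single fault of [V] must create
      [#|I|] neighbours of [I] in [V]: the fault cannot be a vertex, and if it is
      an edge then its set of ends is [I], so that [V] contains only one fault. *)

Set Implicit Arguments.
Unset Strict Implicit.
Unset Printing Implicit Defensive.
Import Order.TTheory GRing.Theory Num.Theory.

(** * Hall's theorem *)

Section Hall.
Variables T U : finType.
Implicit Types (r : T -> pred U) (A B D : {set T}).

Definition nbr r A : {set U} := [set y | [exists x in A, r x y]].

Lemma nbrP r A y : reflect (exists2 x, x \in A & r x y) (y \in nbr r A).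
Proof. by rewrite inE; apply: exists_inP. Qed.

Lemma mem_nbr r A x y : x \in A -> r x y -> y \in nbr r A.
Proof. by move=> xA rxy; apply/nbrP; exists x. Qed.

Lemma nbrS r A B : A \subset B -> nbr r A \subset nbr r B.
Proof.
by move/subsetP=> sAB; apply/subsetP=> y /nbrP[x /sAB]; apply: mem_nbr.
Qed.

Definition hall_on r D : bool :=
  [forall (A : {set T} | A \subset D), #|A| <= #|nbr r A|].

Lemma hall_onP r D :
  reflect (forall A, A \subset D -> #|A| <= #|nbr r A|) (hall_on r D).
Proof. exact: forall_inP. Qed.

Definition remove_pair r x0 y0 : T -> pred U :=
  fun x y => r x y && ((x != x0) || (y != y0)).

Lemma nbr_remove_pair r x0 y0 A :
  x0 \notin A -> nbr (remove_pair r x0 y0) A = nbr r A.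
Proof.
move=> x0A; apply/setP=> y; apply/nbrP/nbrP=> -[x xA].
  by case/andP; exists x.
by move=> rxy; exists x; rewrite // /remove_pair rxy (memPn x0A).
Qed.

(* Two violators [A1], [A2] both contain [x0]; by submodularity of [#|nbr r _|]
   the sets [A1 :|: A2] and [(A1 :&: A2) :\ x0] cannot both be good for [r]. *)
Lemma hall_on_remove_pair r D x0 y1 y2 : hall_on r D -> y1 != y2 ->
  hall_on (remove_pair r x0 y1) D || hall_on (remove_pair r x0 y2) D.
Proof.
move=> /hall_onP hallr y12; apply: contraT; rewrite negb_or => /andP[].
have violator y : ~~ hall_on (remove_pair r x0 y) D ->
    exists A, [/\ A \subset D, x0 \in A & #|nbr (remove_pair r x0 y) A| < #|A|].
  case/forall_inPn=> A sAD; rewrite -ltnNge => ltNA; exists A; split=> //.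
  by apply: contraLR ltNA => x0A; rewrite nbr_remove_pair // -leqNgt hallr.
case/violator=> A1 [sA1D x0A1 ltN1] /violator[A2 [sA2D x0A2 ltN2]].
set N1 := nbr _ A1 in ltN1; set N2 := nbr _ A2 in ltN2.
have sNU : nbr r (A1 :|: A2) \subset N1 :|: N2.
  apply/subsetP=> y /nbrP[x xA rxy]; rewrite inE.
  have [xx0 | xx0] := eqVneq x x0.
    rewrite xx0 in rxy; have [yy1 | yy1] := eqVneq y y1.
      apply/orP; right; apply: mem_nbr x0A2 _.
      by rewrite /remove_pair rxy yy1 y12 orbT.
    by apply/orP; left; apply: mem_nbr x0A1 _; rewrite /remove_pair rxy yy1 orbT.
  by case/setUP: xA => xA; apply/orP; [left | right]; apply: mem_nbr xA _;
     rewrite /remove_pair rxy xx0.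
have sNI : nbr r ((A1 :&: A2) :\ x0) \subset N1 :&: N2.
  apply/subsetP=> y /nbrP[x /setD1P[xx0 /setIP[xA1 xA2]] rxy].
  by rewrite inE; apply/andP; split;
     [apply: mem_nbr xA1 _ | apply: mem_nbr xA2 _];
     rewrite /remove_pair rxy xx0.
have leU : #|A1 :|: A2| <= #|N1 :|: N2|.
  by apply: leq_trans (hallr _ _) (subset_leq_card sNU); rewrite subUset sA1D.
have leI : #|(A1 :&: A2) :\ x0| <= #|N1 :&: N2|.
  apply: leq_trans (hallr _ _) (subset_leq_card sNI).
  by apply: subset_trans sA1D; rewrite (subset_trans (subsetDl _ _)) ?subsetIl.
have := cardsUI A1 A2; have := cardsUI N1 N2.
have := cardsD1 x0 (A1 :&: A2); rewrite inE x0A1 x0A2 /=; lia.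
Qed.

Lemma hall_marriage r : hall_on r setT ->
  exists2 f : T -> U, injective f & forall x, r x (f x).
Proof.
have [m] := ubnP #|[set p : T * U | r p.1 p.2]|.
elim: m => // m IHm in r *; rewrite ltnS => lem hallr.
have [/existsP[x /existsP[y1 /existsP[y2 /and3P[rxy1 rxy2 y12]]]] | functional] :=
  boolP [exists x, exists y1, exists y2, [&& r x y1, r x y2 & y1 != y2]].
  have smaller y : r x y -> hall_on (remove_pair r x y) setT ->
      exists2 f : T -> U, injective f & forall x, r x (f x).
    move=> rxy /IHm[|f f_inj rf]; last by exists f => // z; case/andP: (rf z).
    apply: leq_trans lem; apply/proper_card/properP; split.
      by apply/subsetP=> p; rewrite !inE => /andP[].
    by exists (x, y); rewrite !inE /remove_pair ?eqxx ?andbF.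
  by case/orP: (hall_on_remove_pair x hallr y12) => /smaller; apply.
have [|f rf] := @fin_all_exists T (fun=> U) (fun x y => r x y).
  move=> x; have /(_ [set x] (subsetT _)) := hall_onP _ _ hallr.
  by rewrite cards1 card_gt0 => /set0Pn[y /nbrP[_ /set1P->]]; exists y.
have f_uniq x y : r x y -> y = f x.
  move=> rxy; apply: contraNeq functional => yfx.
  apply/existsP; exists x; apply/existsP; exists y; apply/existsP; exists (f x).
  by rewrite rxy rf.
exists f => // x z fxz.
have sN : nbr r [set x; z] \subset [set f x].
  apply/subsetP=> y /nbrP[w + /f_uniq->]; rewrite in_set2 in_set1.
  by case/orP=> /eqP->; rewrite ?fxz.
have /(_ [set x; z] (subsetT _)) := hall_onP _ _ hallr.
move/leq_trans/(_ (subset_leq_card sN)).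
by rewrite cards1 cards2; case: eqVneq.
Qed.

End Hall.

Lemma hall_on_indep (T : finType) (r : rel T) (D : {set T}) : symmetric r ->
  (forall I : {set T}, I \subset D -> [disjoint I & nbr r I] ->
     #|I| <= #|nbr r I|) ->
  hall_on r D.
Proof.
move=> r_sym indep; apply/hall_onP=> A sAD; set I := A :\: nbr r A.
have sNI : nbr r I \subset nbr r A :\: A.
  apply/subsetP=> y /nbrP[x /setDP[xA xNA] rxy].
  rewrite in_setD (mem_nbr xA rxy) andbT.
  by apply: contra xNA => /mem_nbr; apply; rewrite r_sym.
have : #|I| <= #|nbr r I|.
  apply: indep; first exact: subset_trans (subsetDl _ _) sAD.
  rewrite disjoint_sym; apply: disjointWl sNI _.
  by apply: disjointWr (subsetDl _ _) _; rewrite disjoints_subset subsetDr.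
have := subset_leq_card sNI; have := cardsID (nbr r A) A.
have := cardsID A (nbr r A); rewrite -/I setIC; lia.
Qed.

(** * Fractional perfect matchings *)

Lemma del_adj_sym (T : finType) (e : rel T) FV FE :
  symmetric e -> symmetric (del_adj e FV FE).
Proof.
by move=> e_sym x y; rewrite /del_adj e_sym setUC (andbCA (x \notin FV)).
Qed.

Lemma sumr_pred1 (R : pzSemiRingType) (T : finType) (P : pred T) a : P a ->
  (\sum_(y | P y) (a == y)%:R = 1 :> R)%R.
Proof.
move=> Pa; rewrite (bigD1 a) //= eqxx big1 ?addr0 // => y /andP[_].
by rewrite eq_sym => /negPf->.
Qed.

Section FractionalMatching.
Variables (R : realFieldType) (T : finType) (e : rel T).
Variables (FV : {set T}) (FE : {set {set T}}).
Hypothesis e_sym : symmetric e.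
Notation r := (del_adj e FV FE).

Let r_sym : symmetric r. Proof. exact: del_adj_sym. Qed.

Lemma fpm_hall_on : has_fpm R e FV FE -> hall_on r (~: FV).
Proof.
case=> f [f_sym [f01 f1]]; apply/hall_onP=> A /subsetP sA.
rewrite -(ler_nat R) -!sumr_const.
have -> : (\sum_(x in A) 1 = \sum_(x in A) \sum_(y | r x y) f x y :> R)%R.
  by apply: eq_bigr => x /sA; rewrite inE => /f1.
rewrite (exchange_big_dep (mem (nbr r A))) /=; last by move=> x y; apply: mem_nbr.
apply: ler_sum => y /nbrP[z _ /and4P[_ _ yFV _]].
rewrite -(f1 y yFV) big_mkcondl /=.
rewrite [leRHS](eq_bigl (fun x => r x y)); last by move=> x; rewrite r_sym.
apply: ler_sum => x rxy; rewrite f_sym; case: ifP => // _.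
by have /andP[] : (0 <= f y x <= 1)%R by rewrite f01 // r_sym.
Qed.

Lemma hall_on_matching : hall_on r (~: FV) ->
  exists2 s : T -> T, injective s &
    forall x, if x \in FV then s x = x else r x (s x).
Proof.
move=> /hall_onP hallr; pose r' x y := if x \in FV then x == y else r x y.
have /hall_marriage[s s_inj r's] : hall_on r' setT.
  apply/hall_onP=> A _; rewrite -(cardsID FV A).
  have sAFV : A :\: FV \subset ~: FV by rewrite setDE subsetIr.
  apply: leq_trans (leq_add (leqnn _) (hallr _ sAFV)) _.
  have disj : [disjoint A :&: FV & nbr r (A :\: FV)].
    rewrite disjoint_sym disjoints_subset; apply/subsetP=> y.
    by case/nbrP=> x _ /and4P[_ _ yFV _]; rewrite !inE (negPf yFV) andbF.
  have [_] := leq_card_setU (A :&: FV) (nbr r (A :\: FV)); rewrite disj => /eqP<-.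
  apply: subset_leq_card; apply/subsetP=> y /setUP[/setIP[yA yFV] | /nbrP[x]].
    by apply: mem_nbr yA _; rewrite /r' yFV.
  by case/setDP=> xA xFV rxy; apply: mem_nbr xA _; rewrite /r' (negPf xFV).
by exists s => // x; have := r's x; rewrite /r'; case: ifP => // _ /eqP.
Qed.

(* The cycles of the permutation [s] supplied by Hall's theorem, traversed in
   both directions with weight one half. *)
Lemma hall_on_fpm : hall_on r (~: FV) -> has_fpm R e FV FE.
Proof.
case/hall_on_matching=> s s_inj rs; have [g sK gK] := injF_bij s_inj.
have rsx x : x \notin FV -> r x (s x).
  by move=> xFV; have := rs x; rewrite (negPf xFV).
have rgx x : x \notin FV -> r x (g x).
  move=> xFV; have gxFV : g x \notin FV.
    by apply: contra xFV => gxFV; have := rs (g x); rewrite gxFV gK => ->.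
  by have := rsx _ gxFV; rewrite gK r_sym.
exists (fun x y => ((s x == y)%:R + (s y == x)%:R) / 2%:R)%R; split=> [x y|].
  by rewrite addrC.
split=> [x y _|x xFV].
  rewrite divr_ge0 ?addr_ge0 ?ler0n //= ler_pdivrMr ?ltr0n // mul1r -natrD.
  by rewrite ler_nat; do 2!case: (_ == _).
rewrite -mulr_suml big_split /= sumr_pred1 ?rsx //.
under [X in (1 + X)%R]eq_bigr do rewrite eq_sym -(can2_eq gK sK).
by rewrite sumr_pred1 ?rgx // -[(1 + 1)%R]/(2%:R)%R divff // pnatr_eq0.
Qed.

End FractionalMatching.

(** * Fault tolerance of a set of vertices *)

Definition faults_in (T : finType) (FV : {set T}) (FE : {set {set T}}) U :=
  #|FV :&: U| + #|[set E in FE | E \subset U]|.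

Definition faults_out (T : finType) (FV : {set T}) (FE : {set {set T}}) U :=
  #|FV :\: U| + #|[set E in FE | ~~ (E \subset U)]|.

Definition fault_tolerant (T : finType) (e : rel T) (k : nat) (U : {set T}) :=
  forall (FV : {set T}) (FE : {set {set T}}) (A : {set T}),
    is_edge_set e FE -> faults_in FV FE U <= k -> A \subset U :\: FV ->
    #|A| <= #|nbr (del_adj e FV FE) A :&: U|.

Section Faults.
Variables (T : finType) (e : rel T) (FV : {set T}) (FE : {set {set T}}).
Hypothesis edgeFE : is_edge_set e FE.
Implicit Types (A E U : {set T}).

Lemma card_edge E : E \in FE -> #|E| <= 2.
Proof. by case/edgeFE=> x [y [_ ->]]; rewrite cards2; case: (x != y). Qed.

Lemma is_edge_setD1 E : is_edge_set e (FE :\ E).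
Proof. by move=> E'; rewrite inE => /andP[_ /edgeFE]. Qed.

Lemma faultsID U : faults_in FV FE U + faults_out FV FE U = #|FV| + #|FE|.
Proof.
rewrite /faults_in /faults_out addnACA cardsID; congr addn.
rewrite !setIdE; set inU := [set E : {set T} | E \subset U].
have -> : [set E : {set T} | ~~ (E \subset U)] = ~: inU.
  by apply/setP=> E; rewrite !inE.
by rewrite -setDE cardsID.
Qed.

Lemma leq_faults_in_setC U : faults_in FV FE (~: U) <= faults_out FV FE U.
Proof.
rewrite /faults_in -setDE leq_add2l; apply: subset_leq_card.
apply/subsetP=> E; rewrite !inE => /andP[EFE sEU]; rewrite EFE.
have [x [y [_ defE]]] := edgeFE EFE; have xE : x \in E by rewrite defE set21.
by apply/subsetPn; exists x; rewrite // -in_setC (subsetP sEU).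
Qed.

Lemma faults_in_vertexD1 U w : w \in FV :&: U ->
  faults_in FV FE U = (faults_in (FV :\ w) FE U).+1.
Proof. by move=> wFV; rewrite /faults_in (cardsD1 w) wFV setIDAC. Qed.

Lemma faults_in_edgeD1 U E : E \in FE -> E \subset U ->
  faults_in FV FE U = (faults_in FV (FE :\ E) U).+1.
Proof.
move=> EFE sEU; rewrite /faults_in -addnS (cardsD1 E) inE EFE sEU.
by congr (_ + _.+1); apply: eq_card => E'; rewrite !inE andbA.
Qed.

Lemma nbr_vertexD1 A w : w \notin A ->
  nbr (del_adj e (FV :\ w) FE) A \subset w |: nbr (del_adj e FV FE) A.
Proof.
move=> wA; apply/subsetP=> y /nbrP[x xA]; rewrite /del_adj !inE.
have [-> // | _] := eqVneq y w; rewrite (memPn wA x xA) => rxy.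
by apply/exists_inP; exists x.
Qed.

Lemma nbr_edgeD1 A E y : y \in nbr (del_adj e FV (FE :\ E)) A ->
  y \notin nbr (del_adj e FV FE) A -> exists2 x, x \in A & E = [set x; y].
Proof.
case/nbrP=> x xA rxy yN; exists x => //; apply: contraNeq yN => neqE.
by apply: mem_nbr xA _; move: rxy; rewrite /del_adj !inE eq_sym neqE.
Qed.

Lemma restore_fault U : 0 < faults_in FV FE U ->
  exists (FV' : {set T}) (FE' : {set {set T}}) (E : {set T}),
    [/\ is_edge_set e FE', FV' \subset FV,
        faults_in FV FE U = (faults_in FV' FE' U).+1, #|E| <= 2
      & forall A, A \subset U :\: FV ->
          nbr (del_adj e FV' FE') A \subset E :|: nbr (del_adj e FV FE) A].
Proof.
move=> faulty; have [noV|[w wFV]] := set_0Vmem (FV :&: U); last first.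
  exists (FV :\ w), FE, [set w]; rewrite cards1 subsetDl; split=> //.
    exact: faults_in_vertexD1.
  move=> A sA; apply: nbr_vertexD1; apply/negP=> /(subsetP sA).
  by case/setDP=> _ /negP; apply; case/setIP: wFV.
have [noE|[E]] := set_0Vmem [set E in FE | E \subset U].
  by rewrite /faults_in noV noE !cards0 in faulty.
rewrite inE => /andP[EFE sEU]; exists FV, (FE :\ E), E; split=> //.
- exact: is_edge_setD1.
- exact: faults_in_edgeD1.
- exact: card_edge.
move=> A _; apply/subsetP=> y yN; rewrite inE orbC.
have [// | /(nbr_edgeD1 yN)[x _ ->]] := boolP (y \in nbr (del_adj e FV FE) A).
by rewrite set22.
Qed.

End Faults.

Section FaultTolerant.
Variables (T : finType) (e : rel T) (k : nat) (U : {set T}).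
Hypothesis tolU : fault_tolerant e k U.
Implicit Types (FV A I : {set T}) (FE : {set {set T}}).

(* Delete [k - faults_in FV FE U] further vertices, all neighbours of [I]: the
   remaining neighbours still number at least [#|I|]. *)
Lemma fault_tolerant_expand FV FE I (N := nbr (del_adj e FV FE) I) :
  is_edge_set e FE -> faults_in FV FE U <= k ->
  I \subset U :\: FV -> [disjoint I & N] -> I != set0 ->
  #|I| + (k - faults_in FV FE U) <= #|N :&: U|.
Proof.
move=> edgeFE lek sI disI I_neq0.
have /card_geqP[d [d_uniq d_size sdN]] :=
  geq_minr (k - faults_in FV FE U) #|N :&: U|.
pose D := [set y in d].
have cardD : #|D| = size d by rewrite cardsE (card_uniqP d_uniq).
have sDN : D \subset N :&: U by apply/subsetP=> y; rewrite inE => /sdN.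
have [sDNI sDU] := subsetIP sDN.
have leI : #|I| <= #|nbr (del_adj e (FV :|: D) FE) I :&: U|.
  apply: tolU => //; last first.
    by rewrite -setDDl subsetD sI; apply: disjointWr disI.
  rewrite /faults_in setIUl (setIidPl sDU).
  have := (leq_card_setU (FV :&: U) D).1; move: lek.
  by rewrite cardD d_size /faults_in; lia.
have sN : nbr (del_adj e (FV :|: D) FE) I :&: U \subset (N :&: U) :\: D.
  apply/subsetP=> y /setIP[/nbrP[x xI /and4P[exy]]]; rewrite !in_setU !negb_or.
  case/andP=> xFV _ /andP[yFV yD] xyFE yU; rewrite in_setD in_setI yD yU andbT.
  by apply: mem_nbr xI _; rewrite /del_adj exy xFV yFV.
have := leq_trans leI (subset_leq_card sN).
rewrite cardsD (setIidPr sDN) cardD; move: I_neq0; rewrite -card_gt0; lia.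
Qed.

Lemma fault_tolerant_excess j FV FE A :
  is_edge_set e FE -> faults_in FV FE U <= k + j -> A \subset U :\: FV ->
  #|A| <= #|nbr (del_adj e FV FE) A :&: U| + 2 * j.
Proof.
elim: j => [|j IHj] in FV FE * => edgeFE.
  by rewrite !addn0; apply: tolU.
move=> lekj sA; have [lek | gtk] := leqP (faults_in FV FE U) k.
  exact: leq_trans (tolU edgeFE lek sA) (leq_addr _ _).
have [FV' [FE' [E [edgeFE' sFV' eqF cardE sN]]]] :=
  restore_fault edgeFE (leq_ltn_trans (leq0n k) gtk).
have lekj' : faults_in FV' FE' U <= k + j by rewrite -ltnS -addnS -eqF.
apply: leq_trans (IHj _ _ edgeFE' lekj' (subset_trans sA (setDS _ sFV'))) _.
rewrite mulnS addnA leq_add2r.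
apply: leq_trans (subset_leq_card (setSI U (sN A sA))) _; rewrite setIUl.
apply: leq_trans (leq_card_setU _ _).1 _; rewrite addnC leq_add2l.
exact: leq_trans (subset_leq_card (subsetIl _ _)) cardE.
Qed.

Section Isolated.
Variables (FV I : {set T}) (FE : {set {set T}}).
Hypotheses (edgeFE : is_edge_set e FE) (leF : faults_in FV FE U <= k.+1).
Hypotheses (sI : I \subset U :\: FV) (I_gt1 : 1 < #|I|).
Hypothesis isolatedI : nbr (del_adj e FV FE) I :&: U = set0.

Let notinN y : y \in U -> y \notin nbr (del_adj e FV FE) I.
Proof.
by move=> yU; apply/negP=> yN; have := in_set0 y; rewrite -isolatedI inE yN yU.
Qed.

Lemma isolated_no_vertex_fault : FV :&: U = set0.
Proof.
apply/setP=> w; rewrite in_set0; apply/negP=> wF.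
have wI : w \notin I.
  by apply/negP=> /(subsetP sI); case/setIP: wF; rewrite inE => ->.
have leF' : faults_in (FV :\ w) FE U <= k.
  by rewrite -ltnS -faults_in_vertexD1.
have := tolU edgeFE leF' (subset_trans sI (setDS U (subsetDl FV [set w]))).
apply/negP; rewrite -ltnNge; apply: leq_ltn_trans I_gt1.
rewrite -(cards1 w); apply: subset_leq_card.
apply/subsetP=> y /setIP[/(subsetP (nbr_vertexD1 _ _ _ wI))].
by case/setU1P=> [->|yN] yU; [rewrite inE | case/negP: (notinN yU)].
Qed.

(* The neighbours regained by restoring [E] are ends of [E] whose other end lies
   in [I]; there must be two of them, hence both ends of [E] lie in [I]. *)
Lemma isolated_edge_fault E : E \in FE -> E \subset U -> E = I.
Proof.
move=> EFE sEU; have leF' : faults_in FV (FE :\ E) U <= k.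
  by rewrite -ltnS -faults_in_edgeD1.
have := tolU (is_edge_setD1 (E := E) edgeFE) leF' sI; set N' := _ :&: U => leIN'.
have N'P y : y \in N' -> exists2 x, x \in I & E = [set x; y].
  by case/setIP=> yN yU; apply: nbr_edgeD1 yN (notinN yU).
have N'E : N' = E.
  apply/eqP; rewrite eqEcard (leq_trans (card_edge edgeFE EFE)) ?andbT.
    by apply/subsetP=> y /N'P[x _ ->]; rewrite set22.
  exact: leq_trans leIN'.
apply/eqP; rewrite eqEcard -{2}N'E leIN' andbT; apply/subsetP=> x.
rewrite -{1}N'E => /N'P[z zI defE].
have [|x' x'I defE'] := N'P z; first by rewrite N'E defE set21.
have : x \in [set x'; z] by rewrite -defE' defE set22.
by case/set2P=> ->.
Qed.

Lemma isolated_faults_in : faults_in FV FE U <= 1.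
Proof.
rewrite /faults_in isolated_no_vertex_fault cards0 add0n -(cards1 I).
apply: subset_leq_card; apply/subsetP=> E; rewrite inE => /andP[EFE sEU].
by rewrite inE (isolated_edge_fault EFE sEU).
Qed.

End Isolated.
End FaultTolerant.

(** * Graphs made of two fault-tolerant halves *)

Definition expands_out (T : finType) (e : rel T) (V : {set T}) :=
  forall I : {set T}, I \subset V -> I != set0 ->
    maxn 2 #|I| <= #|nbr e I :\: V|.

Section NbrHalves.
Variables (T : finType) (V : {set T}).
Implicit Types (I : {set T}).

Lemma leq_card_nbr_halves (r : rel T) I :
  #|nbr r (I :&: V) :&: V| + #|nbr r (I :\: V) :&: ~: V| <= #|nbr r I|.
Proof.
rewrite -(cardsID V (nbr r I)) -setDE; apply: leq_add; apply: subset_leq_card.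
  by apply/setSI/nbrS/subsetIl.
by apply/setSD/nbrS/subsetDl.
Qed.

(* Each fault not inside [V] destroys at most one outer neighbour of [I]: an
   outer vertex, or an edge leaving [V], recorded by its outer end. *)
Lemma leq_card_nbr_out (e : rel T) FV FE I : I \subset V :\: FV ->
  #|nbr e I :\: V| <= #|nbr (del_adj e FV FE) I :\: V| + faults_out FV FE V.
Proof.
move=> /subsetP sI; set N := nbr (del_adj e FV FE) I.
pose lost := (nbr e I :\: V) :\: (N :|: FV).
pose partner y := odflt y [pick x in I | e x y].
have partnerP y : y \in lost -> partner y \in I /\ e (partner y) y.
  rewrite !inE => /andP[_ /andP[_ /exists_inP[x xI exy]]]; rewrite /partner.
  by case: pickP => [z /andP[] // | /(_ x)]; rewrite xI exy.
have le_lost : #|lost| <= #|[set E in FE | ~~ (E \subset V)]|.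
  rewrite -(@card_in_imset _ _ (fun y => [set partner y; y])) => [|y z yL zL eqE].
    apply/subset_leq_card/subsetP=> _ /imsetP[y yL ->]; rewrite inE.
    have [pI epy] := partnerP y yL; move: yL; rewrite in_setD in_setU negb_or.
    case/andP=> /andP[yN yFV] /setDP[_ yV]; apply/andP; split; last first.
      by apply/subsetPn; exists y; rewrite ?set22.
    apply: contraR yN => edge_y; apply: (mem_nbr pI).
    by rewrite /del_adj epy yFV edge_y; case/setDP: (sI _ pI) => _ ->.
  have : y \in [set partner z; z] by rewrite -eqE set22.
  case/set2P=> // defy; have [pI _] := partnerP z zL.
  by move: yL; rewrite defy !inE; case/setDP: (sI _ pI) => ->; rewrite andbF.
apply: leq_trans (_ : #|(N :\: V) :|: (FV :\: V) :|: lost| <= _).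
  apply/subset_leq_card/subsetP=> y /setDP[yNe yV].
  by rewrite /lost !(in_setU, in_setD) yNe yV /= andbT orbN.
apply: leq_trans (leq_card_setU _ _).1 _; rewrite addnA leq_add //.
exact: (leq_card_setU _ _).1.
Qed.

End NbrHalves.

Section OverloadedHalf.
Variables (T : finType) (e : rel T) (k : nat) (V : {set T}).
Hypothesis k_ge4 : 4 <= k.
Hypotheses (tolV : fault_tolerant e k V) (tolW : fault_tolerant e k (~: V)).
Hypothesis outV : expands_out e V.
Variables (FV : {set T}) (FE : {set {set T}}).
Hypothesis edgeFE : is_edge_set e FE.
Hypothesis leF : #|FV| + #|FE| <= k + 2.
Hypothesis overV : k < faults_in FV FE V.
Variable I : {set T}.
Hypothesis liveI : I \subset ~: FV.
Notation N := (nbr (del_adj e FV FE)).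

Let leF_out : faults_in FV FE V + faults_out FV FE V <= k + 2.
Proof. by rewrite faultsID. Qed.

Let live J : I :&: J \subset J :\: FV.
Proof. by rewrite setDE setIC setIS. Qed.

Lemma overloaded_hall_outside :
  [disjoint I & N I] -> I :\: V != set0 -> #|I| <= #|N I|.
Proof.
move=> indepI IW_neq0; apply: leq_trans (leq_card_nbr_halves V _ I).
have leV : faults_in FV FE V <= k + (faults_in FV FE V - k) by lia.
have := fault_tolerant_excess tolV edgeFE leV (live V).
have leW := leq_faults_in_setC FV edgeFE V.
have disW : [disjoint I :\: V & N (I :\: V)].
  by apply: disjointWl (subsetDl _ _) (disjointWr (nbrS _ (subsetDl _ _)) indepI).
have leWk : faults_in FV FE (~: V) <= k by lia.
have := fault_tolerant_expand tolW edgeFE leWk (live (~: V)).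
rewrite -setDE => /(_ disW IW_neq0).
have := cardsID V I; lia.
Qed.

Lemma overloaded_hall_inside : I \subset V -> #|I| <= #|N I|.
Proof.
move=> sIV; have [-> | I_neq0] := eqVneq I set0; first by rewrite cards0.
have sI : I \subset V :\: FV by rewrite -[I](setIidPl sIV) live.
have := leq_trans (outV sIV I_neq0) (leq_card_nbr_out e FE sI).
have := cardsID V (N I); rewrite geq_max => cardN /andP[].
have [-> | out1] := posnP (faults_out FV FE V); first lia.
have [isolated | ] := eqVneq (N I :&: V) set0; last by rewrite -card_gt0; lia.
suff : #|I| <= 1 by lia.
rewrite leqNgt; apply/negP=> I_gt1.
have leV : faults_in FV FE V <= k.+1 by lia.
have := isolated_faults_in tolV edgeFE leV sI I_gt1 isolated; lia.
Qed.

Lemma overloaded_hall : [disjoint I & N I] -> #|I| <= #|N I|.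
Proof.
move=> indepI; have [/eqP|] := eqVneq (I :\: V) set0.
  by rewrite setD_eq0; apply: overloaded_hall_inside.
exact: overloaded_hall_outside.
Qed.

End OverloadedHalf.

Lemma two_halves_hall_on (T : finType) (e : rel T) k (V : {set T})
    (FV : {set T}) FE :
  symmetric e -> 4 <= k ->
  fault_tolerant e k V -> fault_tolerant e k (~: V) ->
  expands_out e V -> expands_out e (~: V) ->
  is_edge_set e FE -> #|FV| + #|FE| <= k + 2 ->
  hall_on (del_adj e FV FE) (~: FV).
Proof.
move=> e_sym k_ge4 tolV tolW outV outW edgeFE leF.
apply: hall_on_indep => [|I live indep]; first exact: del_adj_sym.
have [overV | leV] := ltnP k (faults_in FV FE V).
  exact: (overloaded_hall k_ge4 tolV tolW outV).
have [overW | leW] := ltnP k (faults_in FV FE (~: V)).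
  by apply: (overloaded_hall k_ge4 tolW _ outW) => //; rewrite setCK.
have liveU U : I :&: U \subset U :\: FV by rewrite setDE setIC setIS.
apply: leq_trans (leq_card_nbr_halves V _ I).
rewrite -(cardsID V I) leq_add ?tolV ?tolW // setDE; exact: liveU.
Qed.

(** * Induced copies *)

Section InducedCopy.
Variables (T1 T : finType) (e1 : rel T1) (e : rel T) (i : T1 -> T).
Hypotheses (i_inj : injective i) (ei : forall a b, e (i a) (i b) = e1 a b).
Variables (FV : {set T}) (FE : {set {set T}}).
Notation FV1 := (i @^-1: FV).
Notation FE1 := [set E : {set T1} | i @: E \in FE].

Lemma imset_preimset (A : {set T}) : i @: (i @^-1: A) = A :&: i @: setT.
Proof.
apply/setP=> y; apply/imsetP/setIP=> [[x + ->]|[yA /imsetP[x _ yx]]].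
  by rewrite inE imset_f.
by exists x; rewrite // inE -yx.
Qed.

Lemma imset_set2 a b : i @: [set a; b] = [set i a; i b].
Proof. by rewrite imsetU1 imset_set1. Qed.

Lemma is_edge_set_preim : is_edge_set e FE -> is_edge_set e1 FE1.
Proof.
move=> edgeFE E; rewrite inE => iE; have [x [y [exy defE]]] := edgeFE _ iE.
have /imsetP[a _ xa] : x \in i @: E by rewrite defE set21.
have /imsetP[b _ yb] : y \in i @: E by rewrite defE set22.
exists a, b; split; first by rewrite -ei -xa -yb.
by apply: (imset_inj i_inj); rewrite /= imset_set2 -xa -yb.
Qed.

Lemma leq_faults_preim : #|FV1| + #|FE1| <= faults_in FV FE (i @: setT).
Proof.
rewrite /faults_in -imset_preimset card_imset // leq_add2l.
rewrite -(card_imset (mem FE1) (imset_inj i_inj)); apply: subset_leq_card.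
apply/subsetP=> _ /imsetP[E + ->]; rewrite !inE => ->.
exact: imsetS (subsetT E).
Qed.

Lemma del_adj_preim a b : del_adj e FV FE (i a) (i b) = del_adj e1 FV1 FE1 a b.
Proof. by rewrite /del_adj !inE ei imset_set2. Qed.

Lemma imset_nbr_preim (A : {set T}) :
  i @: nbr (del_adj e1 FV1 FE1) (i @^-1: A)
    \subset nbr (del_adj e FV FE) A :&: i @: setT.
Proof.
apply/subsetP=> _ /imsetP[b /nbrP[a + rab] ->]; rewrite inE => iaA.
by rewrite inE imset_f // andbT; apply: mem_nbr iaA _; rewrite del_adj_preim.
Qed.

End InducedCopy.

Lemma fault_tolerant_copy (R : realFieldType) (T1 T : finType) (e1 : rel T1)
    (e : rel T) (i : T1 -> T) k :
  injective i -> (forall a b, e (i a) (i b) = e1 a b) -> symmetric e1 ->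
  (forall FV FE, fsmp_set R e1 FV FE -> k < #|FV| + #|FE|) ->
  fault_tolerant e k (i @: setT).
Proof.
move=> i_inj ei e1_sym fsmp1 FV FE A edgeFE lek sA.
pose FV1 := i @^-1: FV; pose FE1 := [set E : {set T1} | i @: E \in FE].
have /hall_onP hall1 : hall_on (del_adj e1 FV1 FE1) (~: FV1).
  apply: contraLR (leq_trans (leq_faults_preim i_inj FV FE) lek) => not_hall.
  rewrite -ltnNge; apply: fsmp1; split; first exact: is_edge_set_preim edgeFE.
  by move=> /(fpm_hall_on e1_sym); apply/negP.
have sA1 : i @^-1: A \subset ~: FV1.
  by apply/subsetP=> x; rewrite !inE => /(subsetP sA)/setDP[].
have defA : i @: (i @^-1: A) = A.
  by rewrite imset_preimset; apply/setIidPl/(subset_trans sA)/subsetDl.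
rewrite -defA card_imset // defA; apply: leq_trans (hall1 _ sA1) _.
rewrite -(card_imset _ i_inj); apply: subset_leq_card.
exact: imset_nbr_preim.
Qed.

(** * Generalized augmented cubes *)

Definition regular_graph (T : finType) (e : rel T) d :=
  symmetric e /\ forall x, #|[set y | e x y]| = d.

Lemma regular_graph_iso (T1 T2 : finType) (e1 : rel T1) (e2 : rel T2) d :
  graph_iso e1 e2 -> regular_graph e2 d -> regular_graph e1 d.
Proof.
case=> f [[g fK gK] ef] [e2_sym deg2]; split=> [x y|x].
  by rewrite -!ef e2_sym.
rewrite -(deg2 (f x)) -(card_imset _ (can_inj fK)); apply: eq_card => z.
apply/imsetP/idP=> [[y + ->]|]; first by rewrite !inE ef.
by rewrite inE => ez; exists (g z); rewrite ?gK // inE -ef gK.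
Qed.

Lemma card_set_sum (T1 T2 : finType) (P : pred (T1 + T2)) :
  #|[set z | P z]| = #|[set x | P (inl x)]| + #|[set y | P (inr y)]|.
Proof.
rewrite -!sum1_card big_sumType /=.
by congr (_ + _); apply: eq_bigl => x; rewrite !inE.
Qed.

Definition sum_swap {A B : Type} (z : A + B) : B + A :=
  match z with inl a => inr a | inr b => inl b end.

Lemma sum_swapK (A B : Type) : cancel (@sum_swap A B) (@sum_swap B A).
Proof. by case. Qed.

Section GaqJoin.
Variables (T1 T2 : finType) (e1 : rel T1) (e2 : rel T2).
Variables (m1 m2 : T1 -> T2) (h1 h2 : T2 -> T1).
Hypotheses (m1K : cancel m1 h1) (h1K : cancel h1 m1).
Hypotheses (m2K : cancel m2 h2) (h2K : cancel h2 m2).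

Lemma gaq_join_swap z w :
  gaq_join e1 e2 m1 m2 (sum_swap z) (sum_swap w) = gaq_join e2 e1 h1 h2 z w.
Proof.
case: z w => x [y|y] //=; rewrite -(can2_eq h1K m1K) -(can2_eq h2K m2K).
all: by congr orb; apply: eq_sym.
Qed.

Hypothesis m12 : forall x, m1 x != m2 x.

Lemma gaq_join_inv_neq y : h1 y != h2 y.
Proof. by apply: contra (m12 (h1 y)) => /eqP eqh; rewrite {2}eqh h1K h2K. Qed.

Lemma gaq_join_regular d : regular_graph e1 d -> regular_graph e2 d ->
  regular_graph (gaq_join e1 e2 m1 m2) (d + 2).
Proof.
case=> sym1 deg1 [sym2 deg2].
split=> [[x|x] [y|y] //=|[x|y]]; rewrite card_set_sum /=.
  rewrite deg1; have := cards2 (m1 x) (m2 x); rewrite m12 => <-.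
  by congr addn; apply: eq_card => y; rewrite !inE.
rewrite deg2 addnC; have := cards2 (h1 y) (h2 y); rewrite gaq_join_inv_neq => <-.
congr addn; apply: eq_card => x.
by rewrite !inE -(can2_eq m1K h1K) -(can2_eq m2K h2K) ![y == _]eq_sym.
Qed.

End GaqJoin.

Lemma all2_neq_map_negb (u v : seq bool) : size u = size v ->
  all2 (fun x y => x != y) u v = (v == map negb u).
Proof.
elim: u v => [|a u IHu] [|b v] //= [/IHu->].
by rewrite eqseq_cons; case: a b => [] [].
Qed.

Lemma AQ_cons n a b (u v : n.+1.-tuple bool) :
  AQ n.+2 [tuple of a :: u] [tuple of b :: v] =
    if a == b then AQ n.+1 u v else (u == v) || (v == map_tuple negb u).
Proof.
rewrite -!val_eqE /= -all2_neq_map_negb ?size_tuple //.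
by case/tupleP: u => c u; case/tupleP: v.
Qed.

Lemma map_tuple_negbK n : involutive (@map_tuple n _ _ negb).
Proof. by move=> u; apply: val_inj; rewrite /= (mapK negbK). Qed.

Lemma AQ_iso_gaq_join n :
  graph_iso (AQ n.+2) (gaq_join (AQ n.+1) (AQ n.+1) id (map_tuple negb)).
Proof.
pose BT := n.+1.-tuple bool.
exists (fun t : n.+2.-tuple bool =>
  let u : BT := behead_tuple t in if thead t then inr u else inl u); split.
  exists (fun z : BT + BT =>
    match z with
    | inl u => [tuple of false :: u]
    | inr u => [tuple of true :: u]
    end).
    by move=> t; case/tupleP: t => -[] u; rewrite theadE; apply: val_inj.
  by case=> u; rewrite theadE; [congr inl | congr inr]; apply: val_inj.
case/tupleP=> a u; case/tupleP=> b v; rewrite !theadE.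
have beheadE c (w : BT) : behead_tuple [tuple of c :: w] = w.
  exact: val_inj.
rewrite !beheadE AQ_cons; case: a; case: b => //=; last by rewrite [v == u]eq_sym.
by congr (_ || _); rewrite -(inv_eq (@map_tuple_negbK _)) eq_sym.
Qed.

Lemma AQ_regular n : 0 < n -> regular_graph (AQ n) (2 * n - 1).
Proof.
case: n => // n _; elim: n => [|n IHn].
  split=> [x y|x].
    case/tupleP: x => a u; case/tupleP: y => b v.
    by rewrite (tuple0 u) (tuple0 v) /AQ /= eq_sym.
  case/tupleP: x => a u; rewrite (tuple0 u).
  apply: etrans (cards1 [tuple ~~ a]); apply: eq_card => y.
  case/tupleP: y => b v; rewrite (tuple0 v) !inE -val_eqE /AQ /=.
  by case: a b => [] [].
apply: regular_graph_iso (AQ_iso_gaq_join n) _.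
have -> : 2 * n.+2 - 1 = 2 * n.+1 - 1 + 2 by lia.
have negK := @map_tuple_negbK n.+1.
have idK : cancel (@id (n.+1.-tuple bool)) id by [].
apply: (gaq_join_regular (e2 := AQ n.+1) idK idK negK negK _ IHn IHn) => u.
by case/tupleP: u => a u; rewrite -val_eqE /= eqseq_cons; case: a.
Qed.

Lemma GAQ_regular n (T : finType) (e : rel T) :
  GAQ n T e -> regular_graph e (2 * n - 1).
Proof.
elim=> {n T e} [T e iso | n T T1 T2 e e1 e2 m1 m2 n_ge5 _ reg1 _ reg2].
  exact: regular_graph_iso iso (AQ_regular _).
case=> h1 m1K h1K [h2 m2K h2K] m12 iso.
have -> : 2 * n - 1 = 2 * n.-1 - 1 + 2 by lia.
exact: regular_graph_iso iso (gaq_join_regular m1K h1K m2K h2K m12 reg1 reg2).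
Qed.

Lemma GAQ_card n (T : finType) (e : rel T) : GAQ n T e -> #|T| = 2 ^ n.
Proof.
elim=> {n T e} [T e [f [/bij_eq_card-> _]] | n T T1 T2 e e1 e2 m1 m2 n_ge5].
  by rewrite card_tuple card_bool.
move=> _ card1 _ card2 _ _ _ [f [/bij_eq_card-> _]].
by rewrite card_sum card1 card2 addnn -mul2n -expnS prednK //; lia.
Qed.

Lemma gaq_join_expands_out (T T1 T2 : finType) (e : rel T) (e1 : rel T1)
    (e2 : rel T2) (m1 m2 : T1 -> T2) (g : T1 + T2 -> T) :
  injective g -> (forall z w, e (g z) (g w) = gaq_join e1 e2 m1 m2 z w) ->
  injective m1 -> (forall x, m1 x != m2 x) ->
  expands_out e ((g \o inl) @: setT).
Proof.
move=> g_inj eg m1_inj m12 I sI; set V := _ @: setT in sI *.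
have gl_inj : injective (g \o inl) by move=> a b /g_inj[].
have gr_inj : injective (g \o inr) by move=> a b /g_inj[].
pose J := (g \o inl) @^-1: I; pose M := m1 @: J :|: m2 @: J.
have defI : I = (g \o inl) @: J by rewrite imset_preimset (setIidPl sI).
have sM : (g \o inr) @: M \subset nbr e I :\: V.
  apply/subsetP=> _ /imsetP[y yM ->]; rewrite inE; apply/andP; split.
    by apply/imsetP=> -[a _ /g_inj].
  by case/setUP: yM => /imsetP[x xJ ->]; rewrite inE in xJ;
     apply: mem_nbr xJ _; rewrite eg /= eqxx ?orbT.
move=> /set0Pn[z]; rewrite {1}defI => /imsetP[x xJ _].
apply: leq_trans (subset_leq_card sM); rewrite card_imset // geq_max.
apply/andP; split; last first.
  by rewrite {1}defI card_imset // -(card_imset _ m1_inj) subset_leq_card ?subsetUl.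
have sx : [set m1 x; m2 x] \subset M.
  by rewrite subUset !sub1set !inE !imset_f ?orbT.
by apply: leq_trans (subset_leq_card sx); rewrite cards2 m12.
Qed.

Definition gaq_half n (T : finType) (e : rel T) (V : {set T}) :=
  expands_out e V /\
  exists (T1 : finType) (e1 : rel T1) (i : T1 -> T),
    [/\ GAQ n T1 e1, injective i, forall a b, e (i a) (i b) = e1 a b
      & V = i @: setT].

Lemma gaq_join_half n (T T1 T2 : finType) (e : rel T) (e1 : rel T1)
    (e2 : rel T2) (m1 m2 : T1 -> T2) (g : T1 + T2 -> T) :
  injective g -> (forall z w, e (g z) (g w) = gaq_join e1 e2 m1 m2 z w) ->
  injective m1 -> (forall x, m1 x != m2 x) -> GAQ n T1 e1 ->
  gaq_half n e ((g \o inl) @: setT).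
Proof.
move=> g_inj eg m1_inj m12 G1; split.
  exact: gaq_join_expands_out g_inj eg m1_inj m12.
by exists T1, e1, (g \o inl); split=> // [a b /g_inj[] | a b]; rewrite ?eg.
Qed.

Lemma GAQ_halves n (T : finType) (e : rel T) : 5 <= n -> GAQ n T e ->
  exists V : {set T}, gaq_half n.-1 e V /\ gaq_half n.-1 e (~: V).
Proof.
move=> n_ge5 Ge; case: Ge n_ge5 => {n T e} // n T T1 T2 e e1 e2 m1 m2 _ G1 G2.
case=> h1 m1K h1K [h2 m2K h2K] m12 [f [[g fK gK] ef]] _.
have g_inj := can_inj gK.
have eg z w : e (g z) (g w) = gaq_join e1 e2 m1 m2 z w by rewrite -ef !gK.
exists ((g \o inl) @: setT); split.
  exact: gaq_join_half g_inj eg (can_inj m1K) m12 G1.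
have -> : ~: ((g \o inl) @: setT) = (g \o sum_swap \o inl) @: [set: T2].
  apply/setP=> x; rewrite inE -[x]fK; case: (f x) => a.
    by rewrite imset_f //=; apply/esym/imsetP=> -[b _ /g_inj].
  by rewrite (imset_f (g \o sum_swap \o inl)) //; apply/imsetP=> -[b _ /g_inj].
apply: gaq_join_half _ _ (can_inj h1K) (gaq_join_inv_neq h1K h2K m12) G2.
  exact: inj_comp g_inj (can_inj (@sum_swapK _ _)).
by move=> z w; rewrite eg (gaq_join_swap e1 e2 m1K h1K m2K h2K).
Qed.

(** * Fractional strong matching preclusion *)

Lemma fsmp_set_edges_at (R : realFieldType) (T : finType) (e : rel T) x :
  exists FV FE, fsmp_set R e FV FE /\ #|FV| + #|FE| = #|[set y | e x y]|.
Proof.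
exists set0, [set [set x; y] | y in [set y | e x y]]; split; last first.
  rewrite cards0 card_in_imset // => y z _ _ eqxyz.
  have : y \in [set x; z] by rewrite -eqxyz set22.
  have : z \in [set x; y] by rewrite eqxyz set22.
  by rewrite !inE => /orP[/eqP->|/eqP->//] /orP[] /eqP->.
split=> [A /imsetP[y]|]; first by rewrite inE => exy ->; exists x, y.
case=> f [_ [_ /(_ x)]]; rewrite inE big_pred0 => [/(_ isT)/eqP|y].
  by rewrite eq_sym oner_eq0.
apply/negP=> /and4P[exy _ _ /negP]; apply; apply: imset_f.
by rewrite inE.
Qed.

Lemma gaq_half_fault_tolerant (R : realFieldType) n k :
  (forall (T : finType) (e : rel T), GAQ n T e -> fsmp_eq R e k.+1) ->
  forall (T : finType) (e : rel T) (V : {set T}),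
    gaq_half n e V -> fault_tolerant e k V.
Proof.
move=> fsmp_n T e V [_ [T1 [e1 [i [G1 i_inj ei ->]]]]].
have [e1_sym _] := GAQ_regular G1; have [_ min1] := fsmp_n _ _ G1.
exact: fault_tolerant_copy i_inj ei e1_sym min1.
Qed.

Theorem theorem3p2 (R : realFieldType) (n : nat) (hn : 5 <= n) :
  (forall (T : finType) (e : rel T), GAQ n.-1 T e -> fsmp_eq R e (2 * n - 3)) ->
  forall (T : finType) (e : rel T), GAQ n T e -> fsmp_eq R e (2 * n - 1).
Proof.
have -> : 2 * n - 3 = (2 * n - 4).+1 by lia.
move=> /gaq_half_fault_tolerant tolerant T e Ge.
have [e_sym deg] := GAQ_regular Ge; split.
  have /card_gt0P[x _] : 0 < #|T| by rewrite (GAQ_card Ge) expn_gt0.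
  by rewrite -(deg x); apply: fsmp_set_edges_at.
move=> FV FE [edgeFE no_fpm]; rewrite leqNgt; apply/negP=> ltF; apply: no_fpm.
have [V [halfV halfW]] := GAQ_halves hn Ge.
apply/hall_on_fpm/(two_halves_hall_on (k := 2 * n - 4) (V := V)) => //.
- lia.
- exact: tolerant halfV.
- exact: tolerant halfW.
- by case: halfV.
- by case: halfW.
- lia.
Qed.
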